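(* Let $G=(L,R,E)$ be any bipartite graph with $n$ vertices and $m=|E|$ edges and let $\varepsilon\in(0,1)$. Consider the following algorithm. Set importances $q^{(1)}_e=1$ for every $e\in E$ and $Q^{(1)}=\sum_{e\in E}q^{(1)}_e$. For $r=1,\dots,\mathcal{R}$ where $\mathcal{R}=\frac{4}{\varepsilon}\log_2 m$: (a) sample each edge $e\in E$ independently with probability $p^{(r)}_e=\frac{2n}{\varepsilon}\cdot\frac{q^{(r)}_e}{Q^{(r)}}$; (b) compute a maximum matching $M^{(r)}$ and a minimum vertex cover $U^{(r)}$ of the graph formed by the sampled edges; (c) for every edge $e\in E$ not covered by $U^{(r)}$ (i.e. with neither endpoint in $U^{(r)}$) set $q^{(r+1)}_e=2q^{(r)}_e$, and for all other edges set $q^{(r+1)}_e=q^{(r)}_e$; let $Q^{(r+1)}=\sum_{e\in E}q^{(r+1)}_e$. Finally output the largest of the matchings $M^{(1)},\dots,M^{(\mathcal{R})}$. Then with probability at least $1-\exp(-\Theta(n))$, the output is a matching of $G$ of size at least $(1-\varepsilon)\cdot\mu(G)$, where $\mu(G)$ is the maximum matching size of $G$.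
   Context: A vertex cover of a graph is a set of vertices containing at least one endpoint of every edge. The maximum matching $M^{(r)}$ and minimum vertex cover $U^{(r)}$ in step (b) may be any such objects of the sampled subgraph.
   Formalization: The sampling probability is capped at 1 where the formula exceeds 1, and the number of rounds (4/ε)·log₂ m is rounded up and taken to be at least 1 (for m ≤ 1 the formula gives no round or is undefined, leaving no output). *)

(* Defs.v *)
From HB Require Import structures.
From mathcomp Require Import all_boot all_order all_algebra.
From mathcomp Require Import all_classical all_reals all_analysis.

Set Implicit Arguments.
Unset Strict Implicit.
Unset Printing Implicit Defensive.

Import Order.TTheory GRing.Theory Num.Theory.
Local Open Scope ring_scope.

(* A simple bipartite graph with sides [A] and [B] is its edge set
   [E : {set A * B}]; its vertex set is the sum type [A + B], so isolated
   vertices are allowed and count towards [#|{: A + B}|]. *)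
Section Bipartite.
Variables A B : finType.
Implicit Types (E M : {set A * B}) (U : {set A + B}) (e : A * B).

Definition covers U e : bool := (inl e.1 \in U) || (inr e.2 \in U).

Definition is_vertex_cover E U : bool := [forall e in E, covers U e].

Definition is_min_vertex_cover E U : bool :=
  is_vertex_cover E U && [forall U', is_vertex_cover E U' ==> (#|U| <= #|U'|)%N].

Definition is_matching E M : bool :=
  (M \subset E) &&
  [forall e in M, forall f in M, (e != f) ==> (e.1 != f.1) && (e.2 != f.2)].

Definition is_max_matching E M : bool :=
  is_matching E M && [forall M', is_matching E M' ==> (#|M'| <= #|M|)%N].

Definition max_matching_size E : nat := (\max_(M | is_matching E M) #|M|)%N.

Definition is_largest_in (s : seq {set A * B}) M : bool :=
  (M \in s) && all (fun M' => #|M'| <= #|M|)%N s.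

End Bipartite.

(* A history [h : seq {set A * B}] lists the edge sets sampled so far, most
   recent first.  The (arbitrary) maximum matching and minimum vertex cover of
   a round are given by rules [mm] and [vc] applied to the history [h] before
   the round and to the edge set [F] sampled in it, so they may depend on
   everything that happened up to and including that round. *)
Section Algorithm.
Variables (R : realType) (A B : finType) (E : {set A * B}) (eps : R).
Variable mm : seq {set A * B} -> {set A * B} -> {set A * B}.
Variable vc : seq {set A * B} -> {set A * B} -> {set A + B}.
Variable out : seq {set A * B} -> {set A * B}.
Implicit Types (h : seq {set A * B}) (F : {set A * B}) (e : A * B).

(* For [h] of length [r], the importance used in round [r + 1]. *)
Fixpoint importance h e : R :=
  if h is F :: h' then
    if covers (vc h' F) e then importance h' e else 2 * importance h' e
  else 1.

Definition total_importance h : R := \sum_(e in E) importance h e.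

(* The prescribed value may exceed 1; it is then read as probability 1. *)
Definition edge_prob h e : R :=
  Num.min 1 (2 * #|{: A + B}|%:R / eps * (importance h e / total_importance h)).

Definition sample_prob h F : R :=
  if F \subset E then
    \prod_(e in E) (if e \in F then edge_prob h e else 1 - edge_prob h e)
  else 0.

Fixpoint history_prob h : R :=
  if h is F :: h' then history_prob h' * sample_prob h' F else 1.

Fixpoint matchings h : seq {set A * B} :=
  if h is F :: h' then mm h' F :: matchings h' else [::].

(* [4 / eps * log_2 m] rounded up.  At least one round is performed: this only
   matters when [m <= 1], where the formula gives 0 or is undefined. *)
Definition rounds : nat :=
  maxn 1 `|Num.ceil (4 / eps * (ln #|E|%:R / ln 2))|%N.

Definition good_output h : bool :=
  let M := out (matchings h) in
  is_matching E M && ((1 - eps) * (max_matching_size E)%:R <= #|M|%:R).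

Definition success_prob : R :=
  \sum_(h : rounds.-tuple {set A * B} | good_output h) history_prob h.

End Algorithm.

(* Main.v *)
Require Import Defs.
From HB Require Import structures.
From mathcomp Require Import all_boot all_order all_algebra.
From mathcomp Require Import all_classical all_reals all_analysis.
From mathcomp Require Import ring lra zify.

Set Implicit Arguments.
Unset Strict Implicit.
Unset Printing Implicit Defensive.

Import Order.TTheory GRing.Theory Num.Theory.
Local Open Scope ring_scope.

(* Call a round light if the edges left uncovered by its vertex cover carry at
   most an [eps / 2] fraction of the total importance.  A fixed vertex set whose
   uncovered edges are heavier covers the sample with probability at most
   [exp (- n)], so by a union bound over the [2 ^ n] vertex sets a round fails to
   be light with probability at most [(2 / e) ^ n].

   If all rounds are light, then the total importance is at most
   [(1 + eps / 2) ^ r * m] after [r] rounds.  If moreover all matchings had size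
   less than [(1 - eps) * mu], then by Koenig's theorem every cover would miss
   more than [eps * mu] edges of a fixed maximum matching of the graph, so some
   edge of that matching would be doubled at least [eps * r] times.  Comparing
   [2 ^ (eps * r)] with the total importance contradicts
   [r >= 4 / eps * log_2 m], since [ln 2 > 2 / 3].

   The union bound over the rounds needs [r] to be polynomial in [n].  If
   [eps * m <= 2 n], the first round samples every edge with probability 1 and
   is exact; otherwise [1 / eps <= n / 2] and [r <= 7 n ^ 2].  For the finitely
   many [n] for which [7 n ^ 2 * (2 / e) ^ n] is not small, the probability that
   the first round samples the whole graph is bounded below. *)

(** * Matchings and vertex covers; Koenig's theorem by uncrossing *)

Section Matchings.
Variables A B : finType.
Implicit Types (E F M : {set A * B}) (S T U : {set A + B}) (e f : A * B).

Lemma is_vertex_coverP E U :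
  reflect {in E, forall e, covers U e} (is_vertex_cover E U).
Proof. exact: forall_inP. Qed.

Lemma is_matchingP E M :
  reflect (M \subset E /\
           {in M &, forall e f, e != f -> (e.1 != f.1) && (e.2 != f.2)})
          (is_matching E M).
Proof.
apply: (iffP andP) => -[sME mM]; split=> //.
  by move=> e f eM fM; move/forall_inP: mM => /(_ e eM)/forall_inP/(_ f fM)/implyP.
apply/forall_inP => e eM; apply/forall_inP => f fM.
by apply/implyP; apply: mM.
Qed.

Lemma is_matching_sub E F M : F \subset E -> is_matching F M -> is_matching E M.
Proof. by move=> sFE /andP[sMF mM]; rewrite /is_matching (fintype.subset_trans sMF). Qed.

(** Choosing for each covered edge an endpoint in [U] is injective, because edges of a matching
    share no vertex. *)
Lemma card_matching_covered E M U :
  is_matching E M -> (#|[set e in M | covers U e]| <= #|U|)%N.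
Proof.
move=> /is_matchingP[_ mM].
pose v e : A + B := if inl e.1 \in U then inl e.1 else inr e.2.
rewrite -(card_in_imset (f := v)).
  apply: subset_leq_card; apply/fintype.subsetP => _ /imsetP[e /[!inE]/andP[_ ce] ->].
  by rewrite /v; case: ifPn => // h; move: ce; rewrite /covers (negPf h).
move=> e f /[!inE]/andP[eM _]/andP[fM _] evf.
apply/eqP/negPn/negP => /(mM _ _ eM fM)/andP[n1 n2].
by move: evf; rewrite /v; case: ifP => _; case: ifP => _ // [] /eqP;
  rewrite ?(negPf n1) ?(negPf n2).
Qed.

(** Uncrossing: [mix] intersects on the left side and unites on the right, [comix] does the
    opposite. An edge covered by both [S] and [T] is covered by each of the two. *)
Definition mix S T : {set A + B} :=
  [set x | if x is inl _ then (x \in S) && (x \in T) else (x \in S) || (x \in T)].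
Definition comix S T : {set A + B} :=
  [set x | if x is inl _ then (x \in S) || (x \in T) else (x \in S) && (x \in T)].

Lemma card_mix S T : (#|mix S T| + #|comix S T| = #|S| + #|T|)%N.
Proof.
have cE U : #|U| = (\sum_x (x \in U))%N by rewrite -sum1_card big_mkcond.
rewrite !cE -!big_split; apply: eq_bigr => x _ /=.
by rewrite !inE; case: x => x; case: (_ \in S); case: (_ \in T).
Qed.

Lemma covers_mix S T e : covers S e -> covers T e -> covers (mix S T) e.
Proof.
by rewrite /covers !inE; do 4 case: (_ \in _).
Qed.

Lemma covers_comix S T e : covers S e -> covers T e -> covers (comix S T) e.
Proof.
by rewrite /covers !inE; do 4 case: (_ \in _).
Qed.

Lemma covers_setU1 x U e : covers U e -> covers (x |: U) e.
Proof. by rewrite /covers !inE => /orP[]->; rewrite !orbT. Qed.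

(* Deleting an edge either keeps the minimum cover size, or every edge is
   critical.  In the latter case two edges [e], [f] sharing a vertex give covers
   [S] of [E :\ e] and [T] of [E :\ f] of size [tau - 1], and uncrossing them
   yields two covers of [E] (one after adding the shared vertex) that together
   have only [2 tau - 1] vertices. *)
Theorem koenig E U :
  is_min_vertex_cover E U -> exists2 M, is_matching E M & (#|U| <= #|M|)%N.
Proof.
have [k] := ubnP #|E|; elim: k E U => // k IHk E U ltEk /andP[Ucov Umin].
have {}Umin U' : is_vertex_cover E U' -> (#|U| <= #|U'|)%N.
  by move/forallP/(_ U')/implyP: Umin.
have step e : e \in E ->
    (exists2 M, is_matching E M & (#|U| <= #|M|)%N) \/
    (exists2 S, is_vertex_cover (E :\ e) S & (#|S| < #|U|)%N).
  move=> eE; have UcovD : is_vertex_cover (E :\ e) U.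
    by apply/is_vertex_coverP => f /setD1P[_ fE]; exact: (is_vertex_coverP _ _ Ucov).
  have [S Scov Smin] := arg_minnP (fun S => #|S|) UcovD.
  have [ltSU|leUS] := ltnP #|S| #|U|; first by right; exists S.
  left; have [||M mM leSM] := IHk (E :\ e) S.
  - by move: ltEk; rewrite (cardsD1 e E) eE ltnS.
  - by rewrite /is_min_vertex_cover Scov; apply/forallP => S'; apply/implyP/Smin.
  - exists M; last exact: leq_trans leSM.
    exact: is_matching_sub (finset.subsetDl _ _) mM.
have [mE|] := boolP (is_matching E E).
  (* The left endpoints of the edges form a cover with at most [#|E|] vertices. *)
  exists E => //; apply: leq_trans (leq_imset_card (fun e => inl e.1) E).
  apply: Umin; apply/is_vertex_coverP => e eE.
  by apply/orP; left; apply/imsetP; exists e.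
rewrite /is_matching subxx /= => /forall_inPn[e eE /forall_inPn[f fE]].
rewrite negb_imply negb_and !negbK => /andP[nef adj].
have [//|[S /is_vertex_coverP Scov ltSU]] := step e eE.
have [//|[T /is_vertex_coverP Tcov ltTU]] := step f fE.
have nSe : ~~ covers S e.
  apply: contraL ltSU => Se; rewrite -leqNgt; apply: Umin.
  apply/is_vertex_coverP => g gE; have [->//|nge] := eqVneq g e.
  by apply: Scov; rewrite !inE nge.
have nTf : ~~ covers T f.
  apply: contraL ltTU => Tf; rewrite -leqNgt; apply: Umin.
  apply/is_vertex_coverP => g gE; have [->//|ngf] := eqVneq g f.
  by apply: Tcov; rewrite !inE ngf.
have Sf : covers S f by apply: Scov; rewrite !inE eq_sym nef.
have Te : covers T e by apply: Tcov; rewrite !inE nef.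
have cov (X : {set A + B}) : covers X e -> covers X f ->
    (forall g, covers S g -> covers T g -> covers X g) -> (#|U| <= #|X|)%N.
  move=> Xe Xf Xg; apply: Umin; apply/is_vertex_coverP => g gE.
  have [->//|nge] := eqVneq g e; have [->//|ngf] := eqVneq g f.
  by apply: Xg; [apply: Scov|apply: Tcov]; rewrite !inE ?nge ?ngf.
have cardST := card_mix S T.
have cardU1 x (X : {set A + B}) : (#|x |: X| <= #|X|.+1)%N.
  by rewrite cardsU1; case: (_ \notin _).
have uncross (u s t m c : nat) : (s < u)%N -> (t < u)%N -> (m + c = s + t)%N ->
  (u <= m)%N -> (u <= c.+1)%N -> False by lia.
exfalso; case/orP: adj => /eqP adj.
(* A shared left vertex lies in neither [S] nor [T], so both right endpoints lie in [mix S T]; only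
   [comix S T] needs that vertex added. *)
- have leU1 : (#|U| <= #|mix S T|)%N.
    apply: cov; last exact: covers_mix.
      by move: nTf Te; rewrite /covers !inE adj; do 3 case: (_ \in T); rewrite ?orbT.
    by move: nSe Sf; rewrite /covers !inE adj; do 3 case: (_ \in S); rewrite ?orbT.
  have leU2 : (#|U| <= #|inl e.1 |: comix S T|)%N.
    apply: cov => [||g Sg Tg]; last by rewrite covers_setU1 ?covers_comix.
      by rewrite /covers !inE eqxx.
    by rewrite /covers !inE adj eqxx.
  exact: (uncross _ _ _ _ _ ltSU ltTU cardST leU1 (leq_trans leU2 (cardU1 _ _))).
- have leU1 : (#|U| <= #|comix S T|)%N.
    apply: cov; last exact: covers_comix.
      by move: nTf Te; rewrite /covers !inE adj; do 3 case: (_ \in T); rewrite ?orbT.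
    by move: nSe Sf; rewrite /covers !inE adj; do 3 case: (_ \in S); rewrite ?orbT.
  have leU2 : (#|U| <= #|inr e.2 |: mix S T|)%N.
    apply: cov => [||g Sg Tg]; last by rewrite covers_setU1 ?covers_mix.
      by rewrite /covers !inE eqxx orbT.
    by rewrite /covers !inE adj eqxx orbT.
  apply: (uncross _ _ _ _ _ ltSU ltTU _ leU1 (leq_trans leU2 (cardU1 _ _))).
  by rewrite addnC.
Qed.

Lemma max_matching_sizeP E :
  exists2 M, is_matching E M & #|M| = max_matching_size E.
Proof.
have m0 : is_matching E finset.set0.
  by apply/is_matchingP; split=> [|e f]; rewrite ?finset.sub0set // inE.
have [|M mM eM] := @eq_bigmax_cond _ (is_matching E) (fun M => #|M|).
  by apply/card_gt0P; exists finset.set0.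
by exists M.
Qed.

Lemma card_max_matching E M :
  is_max_matching E M -> (max_matching_size E <= #|M|)%N.
Proof.
move=> /andP[_ /forallP maxM]; have [N mN <-] := max_matching_sizeP E.
exact: implyP (maxM N) mN.
Qed.

End Matchings.

(** * Numerical estimates *)

Lemma card_edges (A B : finType) (E : {set A * B}) : (#|E| <= #|{: A + B}| ^ 2)%N.
Proof.
apply: leq_trans (max_card _) _.
by rewrite card_prod card_sum; move: #|A| #|B| => a b; nia.
Qed.

Lemma ln2_gt23 (R : realType) : 2 / 3 < ln 2 :> R.
Proof.
rewrite -ltr_expR lnK ?posrE //.
(* The tenth power of [1 + x <= expR x] at [x = - 1 / 15] is just sharp enough:
   [(14 / 15) ^ 10 > 1 / 2]. *)
have h : (1 - 15^-1) ^+ 10 <= expR (- (2 / 3)) :> R.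
  have -> : - (2 / 3) = (- 15^-1) * 10%:R :> R by field.
  by rewrite expRM_natr lerXn2r ?nnegrE ?expR_ge0 ?expR_ge1Dx //; lra.
have : 2^-1 < expR (- (2 / 3)) :> R by apply: lt_le_trans h; lra.
by rewrite expRN ltf_pV2 ?posrE ?expR_gt0.
Qed.

Lemma two_le_expR56 (R : realType) : 2 <= expR (5 / 6) :> R.
Proof.
have h : (1 + 6^-1) ^+ 5 <= expR (5 / 6) :> R.
  have -> : 5 / 6 = 6^-1 * 5%:R :> R by field.
  by rewrite expRM_natr lerXn2r ?nnegrE ?expR_ge0 ?expR_ge1Dx //; lra.
by apply: le_trans h; lra.
Qed.

(** A fourth power beats the square: [expR (n / 12) >= (n / 48) ^ 4], which is at least [7 * n ^ 2]
    once [n >= 3 * 48 ^ 2], as [3 ^ 2 >= 7]. *)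
Lemma square_le_expR (R : realType) :
  exists N, forall n, (N <= n)%N -> 7 * n%:R ^+ 2 <= expR (n%:R / 12) :> R.
Proof.
pose N := Num.bound (3 * 48 ^+ 2 : R); exists N => n leNn.
have gen : 3 * 48 ^+ 2 <= n%:R :> R.
  apply: (@le_trans _ _ N%:R); last by rewrite ler_nat.
  by apply/ltW/archi_boundP; lra.
have -> : n%:R / 12 = n%:R / 48 * 4%:R :> R by field.
rewrite expRM_natr; apply: (@le_trans _ _ ((n%:R / 48) ^+ 4)); last first.
  rewrite lerXn2r ?nnegrE ?expR_ge0 ?divr_ge0 //.
  by apply: le_trans (expR_ge1Dx _); lra.
set x : R := n%:R in gen *; pose y := x / (3 * 48 ^+ 2).
have xE : x = y * (3 * 48 ^+ 2) by rewrite /y; field.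
have y1 : 1 <= y by rewrite /y ler_pdivlMr ?mul1r //; lra.
rewrite xE.
have -> : (y * (3 * 48 ^+ 2) / 48) ^+ 4 = 9 * (y * (3 * 48 ^+ 2)) ^+ 2 * y ^+ 2 by field.
have : 1 <= y ^+ 2 by rewrite exprn_ege1.
have : 0 <= (y * (3 * 48 ^+ 2)) ^+ 2 by rewrite sqr_ge0.
by move: (_ ^+ 2) (y ^+ 2) => a b; nra.
Qed.

(** * Sums over tuples, split at the head *)

Lemma sum_tuple0 (V : nmodType) (T : finType) (P : pred (seq T)) (f : seq T -> V) :
  \sum_(t : 0.-tuple T | P t) f t = if P [::] then f [::] else 0.
Proof.
rewrite big_mkcond (bigD1 [tuple]) //= big1 ?addr0 // => t.
by move/eqP; rewrite (tuple0 t).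
Qed.

(** The head is the latest round, so a sum over histories splits into the past and one new
    sample. *)
Lemma sum_tupleS (V : nmodType) (T : finType) r (P : pred (seq T)) (f : seq T -> V) :
  \sum_(t : r.+1.-tuple T | P t) f t =
  \sum_(t : r.-tuple T) \sum_(x | P (x :: t)) f (x :: t).
Proof.
rewrite pair_big_dep /=.
rewrite (reindex (fun u : r.-tuple T * T => cons_tuple u.2 u.1)) //=.
exists (fun t : r.+1.-tuple T => (behead_tuple t, thead t)) => [[t x] _|t _] /=.
  by congr pair; apply: val_inj.
by rewrite [RHS]tuple_eta; apply: val_inj.
Qed.

(** * Importances and their growth *)

Section Algorithm.
Variables (R : realType) (A B : finType) (E : {set A * B}) (eps : R).
Variable mm : seq {set A * B} -> {set A * B} -> {set A * B}.
Variable vc : seq {set A * B} -> {set A * B} -> {set A + B}.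
Implicit Types (h : seq {set A * B}) (F M : {set A * B}) (e : A * B).

Local Notation q := (importance R vc).
Local Notation Q := (total_importance R E vc).
Local Notation p := (edge_prob E eps vc).
Local Notation sp := (sample_prob E eps vc).
Local Notation hp := (history_prob E eps vc).
Local Notation n := #|{: A + B}|.

Fixpoint doublings h e : nat :=
  if h is F :: h' then ~~ covers (vc h' F) e + doublings h' e else 0.

Lemma importanceE h e : q h e = 2 ^+ doublings h e.
Proof.
elim: h => [|F h /= ->]; first by rewrite expr0.
by case: covers; rewrite // add1n exprS.
Qed.

Lemma importance_gt0 h e : 0 < q h e.
Proof. by rewrite importanceE exprn_gt0. Qed.

Lemma total_importance_ge0 h : 0 <= Q h.
Proof. by apply: sumr_ge0 => e _; exact/ltW/importance_gt0. Qed.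

Lemma importance_le_total h e : e \in E -> q h e <= Q h.
Proof.
move=> eE; rewrite /total_importance (bigD1 e) //= lerDl.
by apply: sumr_ge0 => f _; exact/ltW/importance_gt0.
Qed.

Lemma total_importance_nil : Q [::] = #|E|%:R.
Proof. by rewrite /total_importance /= sumr_const. Qed.

Definition uncovered_importance h (U : {set A + B}) : R :=
  \sum_(e in E | ~~ covers U e) q h e.

Lemma total_importance_cons F h :
  Q (F :: h) = Q h + uncovered_importance h (vc h F).
Proof.
rewrite /total_importance /uncovered_importance big_mkcondr -big_split.
by apply: eq_bigr => e _ /=; case: covers => /=; rewrite ?addr0 // mulr_natl mulr2n.
Qed.

Definition light_round h F := uncovered_importance h (vc h F) <= eps / 2 * Q h.

Fixpoint light_history h : bool :=
  if h is F :: h' then light_round h' F && light_history h' else true.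

Lemma total_importance_light h : 0 <= eps -> light_history h ->
  Q h <= (1 + eps / 2) ^+ size h * #|E|%:R.
Proof.
move=> eps0; elim: h => [|F h IH] /=.
  by rewrite total_importance_nil expr0 mul1r.
move=> /andP[lF /IH]; rewrite total_importance_cons => le1.
have {lF} : Q h + uncovered_importance h (vc h F) <= (1 + eps / 2) * Q h.
  by rewrite mulrDl mul1r lerD2l.
move=> /le_trans; apply; rewrite exprS -mulrA; apply: ler_wpM2l => //; lra.
Qed.

(** * Small matchings force many doublings *)

Lemma matchings_matching h : (forall h F, F \subset E -> is_max_matching F (mm h F)) ->
  all (fun F => F \subset E) h -> all (is_matching E) (matchings mm h).
Proof.
move=> mmP; elim: h => //= F h IH /andP[sF /IH ->]; rewrite andbT.
by have /andP[/(is_matching_sub sF)] := mmP h _ sF.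
Qed.

(** By Koenig's theorem the cover of a round is no larger than its matching, so it covers at most
    [#|M| - x] edges of [M]; each round thus doubles at least [x] of them. *)
Lemma sum_doublings h (M : {set A * B}) (x : R) :
  (forall h F, F \subset E -> is_max_matching F (mm h F)) ->
  (forall h F, F \subset E -> is_min_vertex_cover F (vc h F)) ->
  is_matching E M ->
  all (fun F => F \subset E) h ->
  all (fun N : {set A * B} => #|N|%:R <= #|M|%:R - x) (matchings mm h) ->
  (size h)%:R * x <= \sum_(e in M) (doublings h e)%:R.
Proof.
move=> mmP vcP mM; elim: h => [|F h IH] /=.
  by rewrite mul0r big1.
move=> /andP[sF /IH{}IH] /andP[small /IH{}IH].
under eq_bigr do rewrite natrD.
rewrite big_split /= -natr1 mulrDl mul1r addrC lerD // -natr_sum.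
have [N mN leUN] := koenig (vcP h _ sF).
have leNM : (#|N| <= #|mm h F|)%N.
  by have /andP[_ /forallP/(_ N)/implyP] := mmP h _ sF; apply.
have cardM : (#|M| <= #|vc h F| + \sum_(e in M) ~~ covers (vc h F) e)%N.
  apply: leq_trans (leq_add (card_matching_covered (vc h F) mM) (leqnn _)).
  rewrite -[#|M|]sum1_card.
  rewrite -[leqRHS]/(#|[set e | (e \in M) && covers (vc h F) e]| + _)%N.
  rewrite -sum1dep_card big_mkcondr -big_split /=.
  by apply: leq_sum => e _; case: covers.
have : #|vc h F|%:R <= #|mm h F|%:R :> R by rewrite ler_nat (leq_trans leUN).
by move: cardM; rewrite -(ler_nat R) natrD; lra.
Qed.

(** * Distribution of one sample *)

Lemma sum_sample_prob h (C : {set A * B}) :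
  \sum_(F : {set A * B} | F \subset C) sp h F = \prod_(e in E | e \notin C) (1 - p h e).
Proof.
(* Presence outside [E] or [C] gets weight 0, so expanding the product over all pairs leaves exactly
   the samples contained in [C]. *)
pose w1 e := if (e \in E) && (e \in C) then p h e else 0.
pose w0 e := if e \in E then 1 - p h e else 1.
have -> : \prod_(e in E | e \notin C) (1 - p h e) = \prod_e (w1 e + w0 e).
  rewrite big_mkcond; apply: eq_bigr => e _; rewrite /w1 /w0.
  case: (e \in E); case: (e \in C) => /=; by rewrite ?add0r // addrC subrK.
rewrite bigA_distr /= big_mkcond; apply: eq_bigr => F _.
rewrite /sample_prob; have [sFC|/fintype.subsetPn[e eF neC]] := boolP (F \subset C); last first.
  by rewrite (bigD1 e) //= eF /w1 (negPf neC) andbF mul0r.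
have [sFE|/fintype.subsetPn[e eF neE]] := boolP (F \subset E); last first.
  by rewrite (bigD1 e) //= eF /w1 (negPf neE) mul0r.
rewrite big_mkcond; apply: eq_bigr => e _; rewrite /w1 /w0.
have [eF|neF] := boolP (e \in F); last by [].
by rewrite (fintype.subsetP sFE) // (fintype.subsetP sFC).
Qed.

Lemma sum_sample_prob1 h : \sum_F sp h F = 1.
Proof.
have := sum_sample_prob h E.
rewrite [X in _ = X]big1 => [<-|e /andP[->] //]; rewrite [RHS]big_mkcond.
by apply: eq_bigr => F _; rewrite /sample_prob; case: ifP.
Qed.

(** The sampling probability before truncation at 1. *)
Definition raw_prob h e : R := 2 * n%:R / eps * (q h e / Q h).

Lemma edge_prob_ge0 h e : 0 <= eps -> 0 <= p h e.
Proof.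
move=> eps0; rewrite le_min ler01 mulr_ge0 ?divr_ge0 ?mulr_ge0 //.
  exact/ltW/importance_gt0.
exact: total_importance_ge0.
Qed.

Lemma edge_prob_le1 h e : p h e <= 1.
Proof. by rewrite ge_min lexx. Qed.

Lemma sample_prob_ge0 h F : 0 <= eps -> 0 <= sp h F.
Proof.
move=> eps0; rewrite /sample_prob; case: ifP => // _.
apply: prodr_ge0 => e _; case: ifP => _; first exact: edge_prob_ge0.
by rewrite subr_ge0 edge_prob_le1.
Qed.

Lemma history_prob_ge0 h : 0 <= eps -> 0 <= hp h.
Proof.
by move=> eps0; elim: h => //= F h IH; rewrite mulr_ge0 // sample_prob_ge0.
Qed.

Lemma history_prob_sub h : hp h != 0 -> all (fun F => F \subset E) h.
Proof.
elim: h => //= F h IH; rewrite mulf_eq0 negb_or => /andP[/IH -> h2].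
by rewrite andbT; move: h2; rewrite /sample_prob; case: ifP; rewrite ?eqxx.
Qed.

(** If [U] covers the sample, every edge missed by [U] was left out. Since
    [1 - min 1 x <= expR (- x)], it remains to see that the raw probabilities of these edges sum to
    at least [2 n / eps * (eps / 2) = n]. *)
Lemma heavy_cover_prob h (U : {set A + B}) : 0 < eps ->
  eps / 2 * Q h < uncovered_importance h U ->
  \sum_(F | is_vertex_cover F U) sp h F <= expR (- n%:R).
Proof.
move=> eps0 heavy; pose C := [set e | covers U e].
have Cv F : is_vertex_cover F U = (F \subset C).
  apply/is_vertex_coverP/fintype.subsetP => H e /H; by rewrite inE.
rewrite (eq_bigl _ _ Cv) sum_sample_prob.
have Q0 : 0 < Q h.
  rewrite lt_neqAle total_importance_ge0 andbT; apply/eqP => Q0.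
  move: heavy; rewrite -Q0 mulr0 /uncovered_importance ltNge => /negP; apply.
  apply: (@le_trans _ _ (Q h)); last by rewrite -Q0.
  rewrite /uncovered_importance /total_importance [leRHS](bigID (covers U)) /= lerDr.
  by apply: sumr_ge0 => e _; exact/ltW/importance_gt0.
apply: (@le_trans _ _ (\prod_(e in E | e \notin C) expR (- raw_prob h e))).
  apply: ler_prod => e _; rewrite subr_ge0 edge_prob_le1 /=.
  rewrite /edge_prob -/(raw_prob h e) minElt; case: ifP => _.
    by rewrite subrr expR_ge0.
  exact: expR_ge1Dx.
rewrite -expR_sum ler_expR sumrN lerN2 /raw_prob -mulr_sumr -mulr_suml.
rewrite (eq_bigl (fun e => (e \in E) && ~~ covers U e)); last first.
  by move=> e; rewrite inE.
rewrite -/(uncovered_importance h U).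
have r0 : 0 <= 2 * n%:R / eps by rewrite divr_ge0 ?mulr_ge0 // ltW.
have le1 : eps / 2 <= uncovered_importance h U / Q h.
  by rewrite ler_pdivlMr // ltW.
apply: le_trans (ler_wpM2l r0 le1).
by rewrite le_eqVlt; apply/orP; left; apply/eqP; field; lra.
Qed.

(** Union bound over the heavy vertex sets, which are determined by the history before the sample is
    drawn. *)
Lemma heavy_round_prob h : 0 < eps ->
  (forall h F, F \subset E -> is_min_vertex_cover F (vc h F)) ->
  \sum_(F | ~~ light_round h F) sp h F <= 2 ^+ n * expR (- n%:R).
Proof.
move=> eps0 vcP; pose heavy U := eps / 2 * Q h < uncovered_importance h U.
apply: (@le_trans _ _
  (\sum_F \sum_(U | heavy U && is_vertex_cover F U) sp h F)).
  rewrite big_mkcond; apply: ler_sum => F _.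
  have nn : 0 <= \sum_(U | heavy U && is_vertex_cover F U) sp h F.
    by apply: sumr_ge0 => U _; rewrite sample_prob_ge0 // ltW.
  case: ifP => // hF; have [sF|nsF] := boolP (F \subset E); last first.
    by move: nn; rewrite /sample_prob (negPf nsF).
  have /andP[cU _] := vcP h F sF.
  (* In a round that is not light, its own cover is one of the heavy sets. *)
  rewrite (bigD1 (vc h F)) /=; last by rewrite cU /heavy ltNge hF.
  by rewrite lerDl; apply: sumr_ge0 => U _; rewrite sample_prob_ge0 // ltW.
rewrite (exchange_big_dep heavy) /=; last by move=> F U _ /andP[].
apply: (@le_trans _ _ (\sum_(U | heavy U) expR (- n%:R))).
  apply: ler_sum => U hU; rewrite (eq_bigl (fun F => is_vertex_cover F U)).
    exact: heavy_cover_prob.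
  by move=> F; rewrite hU.
rewrite sumr_const -[X in X <= _]mulr_natl ler_wpM2r ?expR_ge0 //.
rewrite -natrX ler_nat; apply: leq_trans (max_card _) _.
by rewrite -cardsT -powersetT card_powerset cardsT.
Qed.

(** * Probabilities of whole runs *)

Variable out : seq {set A * B} -> {set A * B}.
Hypothesis eps01 : 0 < eps < 1.
Hypothesis mmP : forall h F, F \subset E -> is_max_matching F (mm h F).
Hypothesis vcP : forall h F, F \subset E -> is_min_vertex_cover F (vc h F).
Hypothesis outP : forall s : seq {set A * B}, s != [::] -> is_largest_in s (out s).

Let eps_gt0 : 0 < eps. Proof. by case/andP: eps01. Qed.

Lemma sum_history_prob r : \sum_(t : r.-tuple {set A * B}) hp t = 1.
Proof.
elim: r => [|r IH]; first by rewrite (sum_tuple0 xpredT).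
rewrite (sum_tupleS _ xpredT) -[RHS]IH; apply: eq_bigr => t _ /=.
by rewrite -mulr_sumr sum_sample_prob1 mulr1.
Qed.

(** Histories are listed most recent first, so [last] is the first sample; the later rounds sum to
    probability 1. *)
Lemma first_round_prob r :
  \sum_(t : r.+1.-tuple {set A * B} | last finset.set0 t == E) hp t =
  \prod_(e in E) p [::] e.
Proof.
elim: r => [|r IH]; rewrite (sum_tupleS _ (fun t => last finset.set0 t == E)).
  rewrite (sum_tuple0 xpredT (fun t => \sum_(x | last x t == E) hp (x :: t))) /=.
  rewrite big_pred1_eq mul1r /sample_prob subxx.
  by apply: eq_bigr => e ->.
rewrite -[RHS]IH [RHS]big_mkcond; apply: eq_bigr => -[[|F s] //= _] _.
rewrite -mulr_sumr; case: ifP => _; first by rewrite sum_sample_prob1 mulr1.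
by rewrite big_pred0_eq mulr0.
Qed.

(** If [r] rounds are light with probability [g <= 1], then [r + 1] rounds are light with
    probability at least [g * (1 - d) >= g - d]. *)
Lemma light_history_prob r :
  1 - r%:R * (2 ^+ n * expR (- n%:R)) <=
  \sum_(t : r.-tuple {set A * B} | light_history t) hp t.
Proof.
set d := 2 ^+ n * _; have d0 : 0 <= d by rewrite mulr_ge0 ?exprn_ge0 ?expR_ge0.
elim: r => [|r IH]; first by rewrite sum_tuple0 /= mul0r subr0.
rewrite (sum_tupleS _ (light_history)) /=.
apply: (@le_trans _ _
  (\sum_(t : r.-tuple {set A * B} | light_history t) hp t * (1 - d))).
  rewrite -mulr_suml; set g := \sum_(t : _ | _) _ in IH *.
  have g1 : g <= 1.
    rewrite -(sum_history_prob r) /g big_mkcond; apply: ler_sum => t _.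
    by case: ifP => // _; exact/history_prob_ge0/ltW.
  by rewrite -natr1; nra.
rewrite big_mkcond; apply: ler_sum => t _; case: ifP => lt; last first.
  by rewrite big_pred0 // => F; rewrite andbF.
under eq_bigl do rewrite andbT.
rewrite -mulr_sumr; apply: ler_wpM2l; first exact/history_prob_ge0/ltW.
have := sum_sample_prob1 t; rewrite (bigID (light_round t)) /=.
have := heavy_round_prob t eps_gt0 vcP; rewrite -/d; lra.
Qed.

(** Histories with a sample not contained in [E] have probability 0, so the implication may assume
    all samples lie in [E]. *)
Lemma success_prob_ge (P : pred (seq {set A * B})) :
  (forall h, size h = rounds E eps -> all (fun F => F \subset E) h -> P h ->
     good_output E eps mm out h) ->
  \sum_(t : (rounds E eps).-tuple {set A * B} | P t) hp t <=
  success_prob E eps mm vc out.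
Proof.
move=> Pgood; rewrite /success_prob big_mkcond [leRHS]big_mkcond.
apply: ler_sum => t _; case: ifP => Pt; last first.
  by case: ifP => // _; exact/history_prob_ge0/ltW.
case: ifP => // ng; have [->//|/history_prob_sub sub] := eqVneq (hp t) 0.
by rewrite Pgood ?size_tuple in ng.
Qed.

(** * Runs with a good output *)

Lemma size_matchings h : size (matchings mm h) = size h.
Proof. by elim: h => //= F h ->. Qed.

Lemma rounds_gt0 : (0 < rounds E eps)%N.
Proof. by rewrite leq_max. Qed.

Lemma good_outputP h (M : {set A * B}) : size h = rounds E eps ->
  all (fun F => F \subset E) h -> M \in matchings mm h ->
  (1 - eps) * (max_matching_size E)%:R <= #|M|%:R -> good_output E eps mm out h.
Proof.
move=> szh sub Mh geM.
have /andP[out_in /allP out_max] : is_largest_in (matchings mm h) (out (matchings mm h)).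
  by apply: outP; rewrite -size_eq0 size_matchings szh -lt0n rounds_gt0.
rewrite /good_output; have /allP -> // := matchings_matching mmP sub.
by apply: le_trans geM _; rewrite ler_nat; exact: out_max.
Qed.

Lemma good_output_first h : size h = rounds E eps ->
  all (fun F => F \subset E) h -> last finset.set0 h == E -> good_output E eps mm out h.
Proof.
move=> szh sub /eqP lastE; apply: (good_outputP (M := mm [::] E)) => //.
  have: h != [::] by rewrite -size_eq0 szh -lt0n rounds_gt0.
  rewrite -lastE; elim: {+}h => //= F [|F' h'] IH _ /=; first by rewrite mem_head.
  by rewrite inE IH ?orbT.
have := card_max_matching (mmP [::] (subxx E)); rewrite -(ler_nat R).
have : 0 <= (max_matching_size E)%:R :> R by [].
by move: eps_gt0; nra.
Qed.

Lemma rounds_ge : 4 / eps * (ln #|E|%:R / ln 2) <= (rounds E eps)%:R.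
Proof.
apply: le_trans (ceil_ge _) _; apply: le_trans (ler_norm _) _.
by rewrite -intr_norm -natr_absz ler_nat leq_maxr.
Qed.

Lemma rounds_le : (rounds E eps)%:R <= 1 + 4 / eps * (ln #|E|%:R / ln 2).
Proof.
set x := _ * _; have x0 : 0 <= x.
  have l2 := @ln2_gt23 R; rewrite mulr_ge0 ?divr_ge0 ?(ltW eps_gt0) //; last by lra.
  have [->|E0] := posnP #|E|; first by rewrite ln0.
  by apply: ln_ge0; rewrite ler1n.
rewrite /rounds -/x; have [_|_] := leqP `|Num.ceil x|%N 1; first by lra.
rewrite natr_absz ger0_norm ?ceil_ge0; last by lra.
by have /andP[] := ceil_itv x; rewrite intrB; lra.
Qed.

Lemma good_output_light h : size h = rounds E eps ->
  all (fun F => F \subset E) h -> light_history h ->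
  good_output E eps mm out h.
Proof.
move=> szh sub light; have eps0 := eps_gt0.
have [M mM cM] := max_matching_sizeP E.
apply/negPn/negP => bad.
have small : all (fun N : {set A * B} => #|N|%:R < (1 - eps) * #|M|%:R)
    (matchings mm h).
  apply/allP => N Nh; rewrite ltNge; apply: contra bad => geN.
  by apply: good_outputP Nh _; rewrite // -cM.
have M0 : 0 < #|M|%:R :> R.
  have: matchings mm h != [::] by rewrite -size_eq0 size_matchings szh -lt0n rounds_gt0.
  case: (matchings mm h) small => //= N s /andP[ltN _] _.
  have : 0 <= #|N|%:R :> R by [].
  by case/andP: eps01 => _ eps1 ?; rewrite -(pmulr_rgt0 _ (_ : 0 < 1 - eps)); lra.
have sumd : (size h)%:R * (eps * #|M|%:R) <= \sum_(e in M) (doublings h e)%:R.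
  apply: sum_doublings => //; apply/allP => N /(allP small) /= ltN; lra.
(* Averaging over the nonempty [M]: some edge is doubled at least as often as the mean. *)
have [e eM ge_e] : exists2 e, e \in M & (size h)%:R * eps <= (doublings h e)%:R.
  apply/exists_inP; apply: contraT => /exists_inPn none; move: sumd; rewrite leNgt => /negP; case.
  rewrite mulrA mulr_natr -sumr_const; apply: ltr_sum => [|e eM].
    have /card_gt0P[e eM] : (0 < #|M|)%N by rewrite -(ltr0n R).
    by apply/hasP; exists e; rewrite ?mem_index_enum.
  by rewrite ltNge none.
have eE : e \in E by have /is_matchingP[/fintype.subsetP->] := mM.
have le1 := importance_le_total h eE.
have := le_trans le1 (total_importance_light (ltW eps0) light).
have cE : 0 < #|E|%:R :> R by rewrite ltr0n; apply/card_gt0P; exists e.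
have l2 := @ln2_gt23 R.
rewrite importanceE -ler_ln ?posrE ?exprn_gt0 ?mulr_gt0 //; last first.
  by rewrite exprn_gt0 //; lra.
rewrite lnXn // lnM ?posrE ?exprn_gt0 ?lnXn //; [|lra..].
rewrite -[_ *+ size h]mulr_natl -[_ *+ doublings _ _]mulr_natl.
have r0 : 0 < (size h)%:R :> R by rewrite szh ltr0n rounds_gt0.
have lne : ln (1 + eps / 2) <= eps / 2 by apply: le_ln1Dx; lra.
have := rounds_ge; rewrite -szh.
set r := (size h)%:R in ge_e r0 *; set d := (doublings h e)%:R in ge_e *.
rewrite mulrA ler_pdivrMr; last by lra.
rewrite mulrAC ler_pdivrMr // => le_m le_d.
(* Altogether [r eps ln 2 <= r eps / 2 + ln m <= r eps / 2 + r eps ln 2 / 4], which would give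
   [ln 2 <= 2 / 3]. *)
have : r * eps * ln 2 <= d * ln 2 by rewrite ler_pM2r //; lra.
have : r * ln (1 + eps / 2) <= r * (eps / 2) by rewrite ler_pM2l.
have : 0 < r * eps * (ln 2 - 2 / 3) by rewrite !mulr_gt0 // subr_gt0.
lra.
Qed.

(** * Bounds on the success probability and on the number of rounds *)

Local Notation m := #|E|.

Lemma success_prob_ge_first :
  \prod_(e in E) edge_prob E eps vc [::] e <= success_prob E eps mm vc out.
Proof.
rewrite -(first_round_prob (rounds E eps).-1).
rewrite prednK ?rounds_gt0 //.
apply: (success_prob_ge (P := fun t => last finset.set0 t == E)).
exact: good_output_first.
Qed.

Lemma success_prob_ge_light :
  1 - (rounds E eps)%:R * (2 ^+ n * expR (- n%:R)) <= success_prob E eps mm vc out.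
Proof.
apply: le_trans (light_history_prob _) _.
apply: (success_prob_ge (P := light_history)).
exact: good_output_light.
Qed.

Lemma edge_prob_nil e :
  edge_prob E eps vc [::] e = Num.min 1 (2 * n%:R / (eps * m%:R)).
Proof.
by rewrite /edge_prob /= total_importance_nil mul1r invfM mulrA.
Qed.

(** Density and [m <= n ^ 2] give [1 / eps <= n / 2]; with [ln m <= 2 n] and [1 / ln 2 <= 3 / 2]
    there are at most [1 + 6 n ^ 2] rounds. *)
Lemma rounds_le_square : 2 * n%:R < eps * m%:R -> (rounds E eps)%:R <= 7 * n%:R ^+ 2 :> R.
Proof.
move=> dense; have /andP[eps0 eps1] := eps01.
have mn : m%:R <= n%:R ^+ 2 :> R by rewrite -natrX ler_nat card_edges.
have m0 : 0 < m%:R :> R.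
  by rewrite -(pmulr_rgt0 _ eps0); apply: le_lt_trans dense; rewrite mulr_ge0.
have n1 : 1 <= n%:R :> R.
  rewrite ler1n lt0n; apply: contraTneq m0 => n0.
  by rewrite -leNgt; apply: le_trans mn _; rewrite n0 expr0n.
have n0 : 0 < n%:R :> R by lra.
have lnm : ln m%:R <= 2 * n%:R :> R.
  apply: (@le_trans _ _ (ln (n%:R ^+ 2))).
    by rewrite ler_ln ?posrE // exprn_gt0.
  rewrite lnXn // -[_ *+ 2]mulr_natl ler_pM2l //.
  exact/ltW/ln_sublinear.
have lnm0 : 0 <= ln m%:R :> R by apply: ln_ge0; rewrite ler1n -(ltr0n R).
have epsn : eps^-1 <= n%:R / 2.
  rewrite -[leRHS]invrK lef_pV2 ?posrE ?invr_gt0 ?divr_gt0 //.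
  rewrite invf_div ler_pdivrMr // -(ler_pM2r n0).
  by apply/ltW/(lt_le_trans dense); rewrite -mulrA -expr2 ler_pM2l.
have l2 := @ln2_gt23 R.
have l2V : (ln 2)^-1 <= 3 / 2 :> R.
  by rewrite -[leRHS]invrK lef_pV2 ?posrE ?invf_div; lra.
apply: le_trans rounds_le _.
have : 4 / eps * (ln m%:R / ln 2) <= 4 * (n%:R / 2) * (2 * n%:R * (3 / 2)).
  have l2V0 : 0 <= (ln 2)^-1 :> R by rewrite invr_ge0; lra.
  apply: ler_pM; rewrite ?mulr_ge0 ?invr_ge0 ?(ltW eps0) //.
  - lra.
  - exact: ler_wpM2l.
  - exact: ler_pM.
have : 1 <= n%:R ^+ 2 :> R by rewrite exprn_ege1.
rewrite expr2; lra.
Qed.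

End Algorithm.

(** * Choice of the constant and case distinction on density and [n] *)

Theorem theorem3p1 (R : realType) :
  exists c : R, 0 < c /\
    forall (A B : finType) (E : {set A * B}) (eps : R)
      (mm : seq {set A * B} -> {set A * B} -> {set A * B})
      (vc : seq {set A * B} -> {set A * B} -> {set A + B})
      (out : seq {set A * B} -> {set A * B}),
    0 < eps < 1 ->
    (forall (h : seq {set A * B}) (F : {set A * B}), F \subset E ->
       is_max_matching F (mm h F)) ->
    (forall (h : seq {set A * B}) (F : {set A * B}), F \subset E ->
       is_min_vertex_cover F (vc h F)) ->
    (forall s : seq {set A * B}, s != [::] -> is_largest_in s (out s)) ->
    1 - expR (- (c * #|{: A + B}|%:R)) <= success_prob E eps mm vc out.
Proof.
have [N largeN] := square_le_expR R.
(* For [n < N] the first round samples all of at most [(N + 1) ^ 2] edges, each with probability at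
   least [1 / (N + 1)]. *)
pose d : R := N.+1%:R^-1 ^+ (N.+1 ^ 2).
have N0 : 0 < N.+1%:R :> R by [].
have d0 : 0 < d by rewrite exprn_gt0 ?invr_gt0.
(* For large [n] the exponent [1 / 12] is what remains of [1 / 6] after the union bound over rounds;
   for [n < N] the second term gives [1 - expR (- (c * n)) <= c * n <= d]. *)
exists (Num.min 12^-1 (d / N.+1%:R)); set c := Num.min _ _; split.
  by rewrite lt_min divr_gt0 // invr_gt0 ltr0n.
move=> A B E eps mm vc out eps01 mmP vcP outP; set n := #|{: A + B}|.
have /andP[eps0 eps1] := eps01.
have first := success_prob_ge_first vc eps01 mmP outP.
have light := success_prob_ge_light eps01 mmP vcP outP.
set s := success_prob _ _ _ _ _ in first light *.
have s1 : \prod_(e in E) edge_prob E eps vc [::] e = 1 -> 1 - expR (- (c * n%:R)) <= s.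
  by move=> h; rewrite h in first; have := expR_ge0 (- (c * n%:R)); lra.
have [E0|m0] := posnP #|E|.
  by apply: s1; rewrite (finset.cards0_eq E0) big_set0.
have {}m0 : 0 < #|E|%:R :> R by rewrite ltr0n.
have [sparse|dense] := leP (eps * #|E|%:R) (2 * n%:R).
  apply: s1; apply: big1 => e _; rewrite edge_prob_nil; apply: min_l.
  by rewrite ler_pdivlMr ?mul1r // mulr_gt0.
have [leNn|ltnN] := leqP N n.
  have le_r := rounds_le_square eps01 dense.
  have le_d : 2 ^+ n * expR (- n%:R) <= expR (- (n%:R / 6)) :> R.
    have -> : - (n%:R / 6) = 5 / 6 * n%:R + - n%:R :> R by field.
    rewrite expRD expRM_natr ler_wpM2r ?expR_ge0 //.
    by rewrite lerXn2r ?nnegrE ?expR_ge0 // two_le_expR56.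
  have le_f : (rounds E eps)%:R * (2 ^+ n * expR (- n%:R)) <=
      expR (n%:R / 12 + - (n%:R / 6)) :> R.
    rewrite expRD; apply: ler_pM => //.
    exact: le_trans le_r (largeN _ leNn).
  have : expR (n%:R / 12 + - (n%:R / 6)) <= expR (- (c * n%:R)).
    rewrite ler_expR.
    have : c * n%:R <= 12^-1 * n%:R by rewrite ler_wpM2r // ge_min lexx.
    lra.
  lra.
have cn : c * n%:R <= d.
  apply: (@le_trans _ _ (d / N.+1%:R * N.+1%:R)); last by rewrite divfK ?lt0r_neq0.
  apply: ler_pM => //; first by rewrite le_min !divr_ge0 ?invr_ge0 // ltW.
    by rewrite ge_min lexx orbT.
  by rewrite ler_nat ltnW // ltnW.
have := expR_ge1Dx (- (c * n%:R)).
suff : d <= s by lra.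
apply: le_trans first.
have mn : (#|E| <= n ^ 2)%N := card_edges E.
have n0 : 0 < n%:R :> R.
  rewrite ltr0n lt0n; apply: contraTneq m0 => n0.
  by move: mn; rewrite n0 leqn0 => /eqP ->; rewrite ltxx.
apply: (@le_trans _ _ (N.+1%:R^-1 ^+ #|E|)).
  rewrite /d; apply: ler_wiXn2l; rewrite ?invr_ge0 ?invf_le1 ?ler1n //.
  by apply: leq_trans mn _; rewrite leq_exp2r // ltnW // ltnW.
rewrite -prodr_const; apply: ler_prod => e _; rewrite invr_ge0 ler0n /=.
rewrite edge_prob_nil le_min invf_le1 ?ler1n //=.
(* The bound holds because [eps * m <= n ^ 2 <= n * (N + 1)]. *)
rewrite -[leLHS]mul1r ler_pdivrMr // mulrAC ler_pdivlMr ?mulr_gt0 // mul1r.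
have : #|E|%:R <= n%:R ^+ 2 :> R by rewrite -natrX ler_nat.
have : n%:R <= N.+1%:R :> R by rewrite ler_nat ltnW // ltnW.
move: eps0 eps1 m0 n0; rewrite expr2.
move: (n%:R : R) (N.+1%:R : R) (#|E|%:R : R) => x y z; nra.
Qed.
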